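(* The class $\mathbb{K}_{\mathbf{mbC}}$ of all swap structures for $\mathbf{mbC}$ is closed under submultialgebras and (direct) products, but it is not closed under homomorphic images (closure being understood up to isomorphism of multialgebras).
   Context: Let $\Sigma=\{\wedge,\vee,\to,\neg,\circ\}$, with $\wedge,\vee,\to$ binary and $\neg,\circ$ unary. A multialgebra over $\Sigma$ is a nonempty set $B$ with, for each $n$-ary symbol $c$, a function $c^{\mathcal{B}}:B^n\to\wp(B)\setminus\{\emptyset\}$; $|\mathcal{B}|=B$. $\mathcal{B}$ is a submultialgebra of $\mathcal{A}$ if $|\mathcal{B}|\subseteq|\mathcal{A}|$ and $c^{\mathcal{B}}(\vec a)\subseteq c^{\mathcal{A}}(\vec a)$ for all $c$ and all $\vec a$ in $|\mathcal{B}|$. A homomorphism $f:\mathcal{A}\to\mathcal{B}$ is a function between the domains with $f[c^{\mathcal{A}}(\vec a)]\subseteq c^{\mathcal{B}}(f(\vec a))$ for all $c,\vec a$; an isomorphism is a bijective $f$ with equality here. The product $\prod_{i\in I}\mathcal{A}_i$ has as domain the cartesian product of the domains and multioperations $c(\vec a)=\prod_{i\in I}c^{\mathcal{A}_i}(\pi_i(\vec a))$ (the one-element multialgebra if $I=\emptyset$). The homomorphic (direct) image of a homomorphism $f:\mathcal{A}\to\mathcal{B}$ is the multialgebra $f(\mathcal{A})$ with domain $f[|\mathcal{A}|]$ and $c^{f(\mathcal{A})}(\vec b)=\bigcup\{f[c^{\mathcal{A}}(\vec a)] : f(\vec a)=\vec b\}$. For a Boolean algebra $\mathcal{A}$ with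 domain $A$ (the one-element Boolean algebra is allowed) and $z\in A^3$ write $z=(z_1,z_2,z_3)$. A swap structure for $\mathbf{mbC}$ over $\mathcal{A}$ is a multialgebra $\mathcal{B}$ over $\Sigma$ with domain $B\subseteq \{z\in A^3 : z_1\vee z_2=1 \text{ and } z_1\wedge z_2\wedge z_3=0\}$ such that $0\in\{z_1: z\in B\}$ and for all $z,w\in B$: (i) $\emptyset\ne z\#w\subseteq\{u\in B: u_1=z_1\# w_1\}$ for $\#\in\{\wedge,\vee,\to\}$; (ii) $\emptyset\neq\neg z\subseteq\{u\in B:u_1=z_2\}$; (iii) $\emptyset\ne\circ z\subseteq\{u\in B:u_1=z_3\}$. $\mathbb{K}_{\mathbf{mbC}}$ is the class of all swap structures for $\mathbf{mbC}$ over arbitrary Boolean algebras. *)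

(* Defs.v *)
From mathcomp Require Import all_boot all_order.
From mathcomp Require Import boolp classical_sets functions.

Set Implicit Arguments.
Unset Printing Implicit Defensive.

Local Open Scope classical_set_scope.

Inductive connective := Conj | Disj | Impl | Neg | Circ.

Definition arity (c : connective) : nat :=
  match c with
  | Conj | Disj | Impl => 2
  | Neg | Circ => 1
  end.

Definition tuple_in (U : Type) (D : set U) (n : nat) (a : n.-tuple U) : Prop :=
  forall i : 'I_n, D (tnth a i).

(* The domain is a set [dom] in an ambient type [U], so that inclusions of     *)
(* domains are literal. Values of [mop] on tuples that are not in [dom] are    *)
(* irrelevant: no notion below depends on them.                                *)
Record multialgebra (U : Type) := Multialgebra {
  dom : set U;
  mop : forall c : connective, (arity c).-tuple U -> set U;
  dom_nonempty : dom !=set0;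
  mop_nonempty : forall c a, tuple_in dom a -> mop c a !=set0;
  mop_dom : forall c a, tuple_in dom a -> mop c a `<=` dom
}.

Arguments mop_nonempty {U m c a}.
Arguments mop_dom {U m c a}.

Definition submultialgebra (U : Type) (B A : multialgebra U) : Prop :=
  dom B `<=` dom A /\
  forall c a, tuple_in (dom B) a -> mop B c a `<=` mop A c a.

Record homomorphism (U V : Type) (A : multialgebra U) (B : multialgebra V) :=
  Homomorphism {
    hom_fun :> U -> V;
    hom_dom : set_fun (dom A) (dom B) hom_fun;
    hom_mop : forall c a, tuple_in (dom A) a ->
      hom_fun @` mop A c a `<=` mop B c (map_tuple hom_fun a)
  }.

Definition isomorphic (U V : Type) (A : multialgebra U) (B : multialgebra V) :
    Prop :=
  exists f : U -> V,
    set_bij (dom A) (dom B) f /\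
    forall c a, tuple_in (dom A) a ->
      f @` mop A c a = mop B c (map_tuple f a).

Section Product.
Variables (I : Type) (U : I -> Type) (A : forall i, multialgebra (U i)).

Definition prod_dom : set (forall i, U i) :=
  [set x | forall i, dom (A i) (x i)].

Definition prod_mop (c : connective) (a : (arity c).-tuple (forall i, U i)) :
    set (forall i, U i) :=
  [set x | forall i, mop (A i) c (map_tuple (fun y => y i) a) (x i)].

Lemma prod_tuple_in n (a : n.-tuple (forall i, U i)) i :
  tuple_in prod_dom a -> tuple_in (dom (A i)) (map_tuple (fun y => y i) a).
Proof. by move=> aD k; rewrite tnth_map; exact: aD. Qed.

Lemma prod_dom_nonempty : prod_dom !=set0.
Proof.
exists (fun i => sval (cid (dom_nonempty (A i)))) => i.
by case: (cid _).
Qed.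

Lemma prod_mop_nonempty c a : tuple_in prod_dom a -> prod_mop c a !=set0.
Proof.
move=> aD.
exists (fun i => sval (cid (mop_nonempty (prod_tuple_in i aD)))) => i.
by case: (cid _).
Qed.

Lemma prod_mop_dom c a : tuple_in prod_dom a -> prod_mop c a `<=` prod_dom.
Proof.
by move=> aD x xP i; exact: (mop_dom (prod_tuple_in i aD) _ (xP i)).
Qed.

Definition product : multialgebra (forall i, U i) :=
  {| dom := prod_dom;
     mop := prod_mop;
     dom_nonempty := prod_dom_nonempty;
     mop_nonempty := prod_mop_nonempty;
     mop_dom := prod_mop_dom |}.

End Product.

Arguments product {I U} A.

Section HomImage.
Variables (U V : Type) (A : multialgebra U) (B : multialgebra V).
Variable f : homomorphism A B.

Definition image_dom : set V := f @` dom A.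

Definition image_mop (c : connective) (b : (arity c).-tuple V) : set V :=
  \bigcup_(a in [set a | tuple_in (dom A) a /\ map_tuple f a = b])
    (f @` mop A c a).

Lemma image_dom_nonempty : image_dom !=set0.
Proof. by have [x xA] := dom_nonempty A; exists (f x), x. Qed.

Lemma image_mop_nonempty c b : tuple_in image_dom b -> image_mop c b !=set0.
Proof.
move=> bD.
have b_image i : exists x, dom A x /\ f x = tnth b i.
  by have [x xA fx] := bD i; exists x.
have [g gP] := choice b_image.
pose a := [tuple g i | i < arity c].
have aA : tuple_in (dom A) a.
  by move=> i; rewrite tnth_mktuple; have [] := gP i.
have [y yP] := mop_nonempty aA.
exists (f y); exists a; last by exists y.
split=> //; apply: eq_from_tnth => i.
by rewrite tnth_map tnth_mktuple; have [] := gP i.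
Qed.

Lemma image_mop_dom c b : tuple_in image_dom b -> image_mop c b `<=` image_dom.
Proof.
by move=> _ _ [a [aA _] [y yP <-]]; exists y => //; exact: (mop_dom aA _ yP).
Qed.

Definition hom_image : multialgebra V :=
  {| dom := image_dom;
     mop := image_mop;
     dom_nonempty := image_dom_nonempty;
     mop_nonempty := image_mop_nonempty;
     mop_dom := image_mop_dom |}.

End HomImage.

Section Swap.
Variables (d : Order.disp_t) (A : ctbDistrLatticeType d).
Local Open Scope order_scope.

(* The first, second and third components of [z] are [z.1.1], [z.1.2], [z.2].  *)
Definition swap_universe : set (A * A * A) :=
  [set z : A * A * A |
     z.1.1 `|` z.1.2 = \top /\ z.1.1 `&` z.1.2 `&` z.2 = \bot].

Definition bool_impl (x y : A) : A := ~` x `|` y.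

Definition is_swap_mbC (B : multialgebra (A * A * A)) : Prop :=
  [/\ dom B `<=` swap_universe,
      exists2 z, dom B z & z.1.1 = \bot,
      forall z w, dom B z -> dom B w ->
        [/\ mop B Conj [tuple z; w] `<=`
              [set u | dom B u /\ u.1.1 = z.1.1 `&` w.1.1],
            mop B Disj [tuple z; w] `<=`
              [set u | dom B u /\ u.1.1 = z.1.1 `|` w.1.1]
          & mop B Impl [tuple z; w] `<=`
              [set u | dom B u /\ u.1.1 = bool_impl z.1.1 w.1.1]],
      forall z, dom B z ->
        mop B Neg [tuple z] `<=` [set u | dom B u /\ u.1.1 = z.1.2]
    & forall z, dom B z ->
        mop B Circ [tuple z] `<=` [set u | dom B u /\ u.1.1 = z.2]].

End Swap.

Arguments bool_impl {d A} x y.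

Definition multialgebra_class := forall U : Type, multialgebra U -> Prop.

(* Mathcomp's [ctbDistrLatticeType] does not require [\bot != \top], so it     *)
(* includes the one-element Boolean algebra.                                   *)
Inductive K_mbC : multialgebra_class :=
  K_mbC_intro (d : Order.disp_t) (A : ctbDistrLatticeType d)
    (B : multialgebra (A * A * A)) : is_swap_mbC A B -> K_mbC B.

Definition in_up_to_iso (K : multialgebra_class) (U : Type)
    (A : multialgebra U) : Prop :=
  exists (V : Type) (B : multialgebra V), K V B /\ isomorphic A B.

Definition closed_under_submultialgebras (K : multialgebra_class) : Prop :=
  forall (U : Type) (A B : multialgebra U),
    K U A -> submultialgebra B A -> in_up_to_iso K B.

Definition closed_under_products (K : multialgebra_class) : Prop :=
  forall (I : Type) (U : I -> Type) (A : forall i, multialgebra (U i)),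
    (forall i, K (U i) (A i)) -> in_up_to_iso K (product A).

Definition closed_under_homomorphic_images (K : multialgebra_class) : Prop :=
  forall (U V : Type) (A : multialgebra U) (B : multialgebra V)
    (f : homomorphism A B),
    K U A -> in_up_to_iso K (hom_image f).

(* Main.v *)
From HB Require Import structures.
From mathcomp Require Import all_boot all_order.
From mathcomp Require Import boolp classical_sets functions.
Require Import Defs.

(** A submultialgebra contains an element with first component [0] because the
    first components of the values of [z /\ ~ z /\ o z] are
    [z_1 /\ z_2 /\ z_3 = 0]. A product of swap structures over [A_i] becomes, by
    transposing families of triples into triples of families, a swap structure
    over the product of the [A_i].
    For homomorphic images, take all triples over the two-element algebra and
    project to the third component. Among the values of [(0,1,1) /\ (0,1,1)] are
    [(0,1,1)] and [(0,1,0)], so in the two-element image both elements are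
    values of one conjunction. In a swap structure they would have the same
    first component, which would be [0]; implication then gives [0 = 1], and the
    Boolean algebra and the swap structure would have a single element. *)

Set Implicit Arguments.
Unset Strict Implicit.
Unset Printing Implicit Defensive.

Import Order.Theory.
Local Open Scope classical_set_scope.

(* An alias of the dependent function space, which keeps its order apart from
   the one that boolp puts on non-dependent functions. *)
Definition dprod (I : Type) (T : I -> Type) : Type := forall i, T i.

HB.instance Definition _ (I : Type) (T : I -> Type) := gen_eqMixin (dprod T).
HB.instance Definition _ (I : Type) (T : I -> Type) :=
  gen_choiceMixin (dprod T).

(** * The pointwise Boolean algebra on a product of Boolean algebras *)

Section DependentProductOrder.
Variables (I : Type) (d : I -> Order.disp_t).
Variable L : forall i, ctbDistrLatticeType (d i).
Local Open Scope order_scope.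

Let T := dprod L.
Implicit Types x y z : T.

Let meet x y : T := fun i => x i `&` y i.
Let join x y : T := fun i => x i `|` y i.
(** Defining the order through meets turns the bounds into pointwise equations; the Boolean test
    relies on the classical equality given to [dprod]. *)
Let le x y := meet x y == x.
Let lt x y := (y != x) && le x y.

Let dprod_ext x y : (forall i, x i = y i) -> x = y.
Proof. exact: functional_extensionality_dep. Qed.

Let meetC : commutative meet.
Proof. by move=> x y; apply: dprod_ext => i; apply: meetC. Qed.

Let joinC : commutative join.
Proof. by move=> x y; apply: dprod_ext => i; apply: joinC. Qed.

Let meetA : associative meet.
Proof. by move=> x y z; apply: dprod_ext => i; apply: meetA. Qed.

Let joinA : associative join.
Proof. by move=> x y z; apply: dprod_ext => i; apply: joinA. Qed.

Let joinKI y x : meet x (join x y) = x.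
Proof. by apply: dprod_ext => i; apply: joinKI. Qed.

Let meetKU y x : join x (meet x y) = x.
Proof. by apply: dprod_ext => i; apply: meetKU. Qed.

Let meetUl : left_distributive meet join.
Proof. by move=> x y z; apply: dprod_ext => i; apply: meetUl. Qed.

Let meetxx : idempotent_op meet.
Proof. by move=> x; apply: dprod_ext => i; apply: meetxx. Qed.

HB.instance Definition _ :=
  @Order.isMeetJoinDistrLattice.Build (Order.Disp tt tt) (dprod L)
    le lt meet join (fun _ _ => erefl) (fun _ _ => erefl)
    meetC joinC meetA joinA joinKI meetKU meetUl meetxx.

Let le0x x : ((fun=> \bot) : T) <= x.
Proof. by apply/eqP; apply: dprod_ext => i; apply: meet0x. Qed.

Let lex1 x : x <= ((fun=> \top) : T).
Proof. by apply/eqP; apply: dprod_ext => i; apply: meetx1. Qed.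

HB.instance Definition _ :=
  Order.hasBottom.Build (Order.Disp tt tt) (dprod L) le0x.
HB.instance Definition _ :=
  Order.hasTop.Build (Order.Disp tt tt) (dprod L) lex1.

Let joinxC x : x `|` ((fun i => ~` x i) : T) = \top.
Proof. by apply: dprod_ext => i; apply: joinxC. Qed.

Let meetxC x : x `&` ((fun i => ~` x i) : T) = \bot.
Proof. by apply: dprod_ext => i; apply: meetxC. Qed.

HB.instance Definition _ :=
  Order.TBDistrLattice_hasComplement.Build (Order.Disp tt tt) (dprod L)
    joinxC meetxC.

End DependentProductOrder.

(** * Transport of a multialgebra along a bijection *)

Section Transport.
Variables (U V : Type) (A : multialgebra U) (f : U -> V) (g : V -> U).
Hypotheses (fK : cancel f g) (gK : cancel g f).

Let tuple_in_transport n (a : n.-tuple V) :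
  tuple_in (g @^-1` dom A) a -> tuple_in (dom A) (map_tuple g a).
Proof. by move=> aD i; rewrite tnth_map; exact: aD. Qed.

Let transport_dom_nonempty : g @^-1` dom A !=set0.
Proof. by have [x xA] := dom_nonempty A; exists (f x); rewrite /= fK. Qed.

Let transport_mop c (a : (arity c).-tuple V) : set V :=
  g @^-1` mop A c (map_tuple g a).

Let transport_mop_nonempty c a :
  tuple_in (g @^-1` dom A) a -> @transport_mop c a !=set0.
Proof.
move=> /tuple_in_transport /mop_nonempty [x xP].
by exists (f x); rewrite /transport_mop /= fK.
Qed.

Let transport_mop_dom c a :
  tuple_in (g @^-1` dom A) a -> @transport_mop c a `<=` g @^-1` dom A.
Proof. by move=> /tuple_in_transport /mop_dom aD x /aD. Qed.

(** With preimages under [g] instead of images under [f], membership in the domain unfolds by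
    conversion, without a witness to extract. *)
Definition transport : multialgebra V :=
  {| dom := g @^-1` dom A;
     mop := transport_mop;
     dom_nonempty := transport_dom_nonempty;
     mop_nonempty := transport_mop_nonempty;
     mop_dom := transport_mop_dom |}.

Lemma isomorphic_transport : isomorphic A transport.
Proof.
exists f; split.
  split.
  - by move=> x xA; rewrite /= fK.
  - by move=> x y _ _ /(can_inj fK).
  - by move=> y yA; exists (g y).
move=> c a _; rewrite /= /transport_mop.
have -> : map_tuple g (map_tuple f a) = a.
  by apply: eq_from_tnth => i; rewrite !tnth_map fK.
apply/seteqP; split=> [_ [x xP <-]|y yP]; first by rewrite /= fK.
by exists (g y).
Qed.

End Transport.

Lemma isomorphic_refl (U : Type) (A : multialgebra U) : isomorphic A A.
Proof.
exists id; split.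
  by split=> [x|x y _ _|x xA] //; exists x.
move=> c a _; rewrite image_id; congr (mop A c _).
by apply: eq_from_tnth => i; rewrite tnth_map.
Qed.

Lemma map_tuple1 (T U : Type) (f : T -> U) x :
  map_tuple f [tuple x] = [tuple f x].
Proof. exact: val_inj. Qed.

Lemma map_tuple2 (T U : Type) (f : T -> U) x y :
  map_tuple f [tuple x; y] = [tuple f x; f y].
Proof. exact: val_inj. Qed.

Lemma tuple_in1 (U : Type) (D : set U) x : D x -> tuple_in D [tuple x].
Proof. by move=> Dx i; rewrite ord1. Qed.

Lemma tuple_in2 (U : Type) (D : set U) x y :
  D x -> D y -> tuple_in D [tuple x; y].
Proof.
move=> Dx Dy i; rewrite (tnth_nth x).
by case: i => -[|[|i]].
Qed.

(** * Submultialgebras *)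

Lemma submultialgebra_swap (d : Order.disp_t) (L : ctbDistrLatticeType d)
    (A B : multialgebra (L * L * L)) :
  is_swap_mbC L A -> submultialgebra B A -> is_swap_mbC L B.
Proof.
move=> [Auniv _ Abin Aneg Acirc] [BA opBA].
(* Values stay in [dom B] because [B] is itself a multialgebra; only their first components are
   inherited from [A]. *)
have restr c a x : tuple_in (dom B) a ->
    mop A c a `<=` [set u | dom A u /\ u.1.1 = x] ->
    mop B c a `<=` [set u | dom B u /\ u.1.1 = x].
  move=> aB opA u uP; split; first exact: (mop_dom aB _ uP).
  by have [] := opA u (opBA c a aB u uP).
have binP z w : dom B z -> dom B w ->
    [/\ mop B Conj [tuple z; w] `<=`
          [set u | dom B u /\ u.1.1 = (z.1.1 `&` w.1.1)%O],
        mop B Disj [tuple z; w] `<=`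
          [set u | dom B u /\ u.1.1 = (z.1.1 `|` w.1.1)%O]
      & mop B Impl [tuple z; w] `<=`
          [set u | dom B u /\ u.1.1 = bool_impl z.1.1 w.1.1]].
  move=> zB wB; have zwB := tuple_in2 zB wB.
  by have [? ? ?] := Abin z w (BA _ zB) (BA _ wB); split; apply: restr.
have negP z : dom B z ->
    mop B Neg [tuple z] `<=` [set u | dom B u /\ u.1.1 = z.1.2].
  by move=> zB; exact: (restr Neg) (tuple_in1 zB) (Aneg z (BA _ zB)).
have circP z : dom B z ->
    mop B Circ [tuple z] `<=` [set u | dom B u /\ u.1.1 = z.2].
  by move=> zB; exact: (restr Circ) (tuple_in1 zB) (Acirc z (BA _ zB)).
split=> // [z /BA /Auniv //|].
(* All values [n], [o], [p], [q] are chosen in [B]; [q] comes from the conjunction of [p] in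
   [z /\ n] with [o]. *)
have [z zB] := dom_nonempty B.
have [n nP] := mop_nonempty (c := Neg) (tuple_in1 zB).
have [nB nE] := negP z zB n nP.
have [o oP] := mop_nonempty (c := Circ) (tuple_in1 zB).
have [oB oE] := circP z zB o oP.
have [p pP] := mop_nonempty (c := Conj) (tuple_in2 zB nB).
have [/(_ p pP) [pB pE] _ _] := binP z n zB nB.
have [q qP] := mop_nonempty (c := Conj) (tuple_in2 pB oB).
have [/(_ q qP) [qB qE] _ _] := binP p o pB oB.
exists q => //; rewrite qE pE nE oE.
by have [_] := Auniv z (BA z zB).
Qed.

(** * Products *)

Section ProductOfSwaps.
Variables (I : Type) (d : I -> Order.disp_t).
Variable L : forall i, ctbDistrLatticeType (d i).
Variable M : forall i, multialgebra (L i * L i * L i).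

Definition unzip3 (x : forall i, (L i * L i * L i)%type) :
    dprod L * dprod L * dprod L :=
  (fun i => (x i).1.1, fun i => (x i).1.2, fun i => (x i).2).

Definition zip3 (z : dprod L * dprod L * dprod L) i : L i * L i * L i :=
  (z.1.1 i, z.1.2 i, z.2 i).

Lemma unzip3K : cancel unzip3 zip3.
Proof.
move=> x; apply: functional_extensionality_dep => i.
by rewrite /zip3 /=; case: (x i) => -[].
Qed.

Lemma zip3K : cancel zip3 unzip3.
Proof. by move=> [[]]. Qed.

Definition swap_product := transport (product M) unzip3K.

(** Reduces each swap axiom for the product to the same axiom in the factor [M i]. *)
Lemma swap_product_mop c (a : (arity c).-tuple _) u i :
  mop swap_product c a u ->
  mop (M i) c (map_tuple (zip3^~ i) a) (zip3 u i).
Proof.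
move=> /(_ i); congr (mop (M i) c _ _).
by apply: eq_from_tnth => k; rewrite !tnth_map.
Qed.

Lemma swap_product_swap :
  (forall i, is_swap_mbC (L i) (M i)) -> is_swap_mbC (dprod L) swap_product.
Proof.
move=> Mswap.
have ext (x y : dprod L) : (forall i, x i = y i) -> x = y.
  exact: functional_extensionality_dep.
split.
- move=> z zD; split; apply: ext => i.
    by have [/(_ _ (zD i)) [] ] := Mswap i.
  by have [/(_ _ (zD i)) [] ] := Mswap i.
- have ex0 i : exists z, dom (M i) z /\ z.1.1 = \bot%O.
    by have [_ [z zD z0] _ _ _] := Mswap i; exists z.
  (* The axiom of choice picks one such element in every factor. *)
  pose s i := sval (cid (ex0 i)).
  have sP i : dom (M i) (s i) /\ (s i).1.1 = \bot%O.
    exact: svalP (cid (ex0 i)).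
  exists (unzip3 s); first by rewrite /= unzip3K => i; have [] := sP i.
  by apply: ext => i; have [] := sP i.
- move=> z w zD wD; have zwD := tuple_in2 zD wD.
  split=> u uP; (split; first exact: (mop_dom _ _ uP)); apply: ext => i;
    have := swap_product_mop i uP; rewrite map_tuple2 => uPi;
    have [_ _ /(_ _ _ (zD i) (wD i)) [Hc Hd Hi] _ _] := Mswap i.
  + by have [] := Hc _ uPi.
  + by have [] := Hd _ uPi.
  + by have [] := Hi _ uPi.
- move=> z zD u uP.
  split; first exact: (mop_dom (c := Neg) (tuple_in1 zD) _ uP).
  apply: ext => i; have := swap_product_mop i uP; rewrite map_tuple1 => uPi.
  by have [_ _ _ /(_ _ (zD i) _ uPi) []] := Mswap i.
- move=> z zD u uP.
  split; first exact: (mop_dom (c := Circ) (tuple_in1 zD) _ uP).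
  apply: ext => i; have := swap_product_mop i uP; rewrite map_tuple1 => uPi.
  by have [_ _ _ _ /(_ _ (zD i) _ uPi) []] := Mswap i.
Qed.

End ProductOfSwaps.

(** Membership in [K_mbC] is a proposition; bundling the Boolean algebra with its swap structure
    lets choice select both at once for every index. *)
Record swap_structure := SwapStructure {
  swap_disp : Order.disp_t;
  swap_alg : ctbDistrLatticeType swap_disp;
  swap_multialgebra : multialgebra (swap_alg * swap_alg * swap_alg);
  swap_axioms : is_swap_mbC swap_alg swap_multialgebra
}.

Definition swap_package (S : swap_structure) : {U : Type & multialgebra U} :=
  existT _ _ (swap_multialgebra S).

Lemma K_mbC_package (U : Type) (A : multialgebra U) :
  K_mbC A -> exists S, existT _ U A = swap_package S.
Proof. by case=> d L B swapB; exists (SwapStructure swapB). Qed.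

Lemma K_mbC_sub : closed_under_submultialgebras K_mbC.
Proof.
move=> U A B KA; case: KA B => d L {U}A swapA B BA.
exists (L * L * L)%type, B; split; last exact: isomorphic_refl.
exact: K_mbC_intro (submultialgebra_swap swapA BA).
Qed.

Lemma K_mbC_product : closed_under_products K_mbC.
Proof.
move=> I U A KA.
pose F i := existT multialgebra (U i) (A i).
have [S FS] := choice (fun i => K_mbC_package (KA i)).
(* Replacing the packages [(U i, A i)] rather than [A] alone avoids casts along
   the equalities between [U i] and the ambient type of [S i]. *)
suff : in_up_to_iso K_mbC (product (fun i => projT2 (F i))) by [].
have -> : F = (fun i => swap_package (S i)) by apply/funext => i; exact: FS.
eexists _, (swap_product (fun i => swap_multialgebra (S i))); split.
  exact: K_mbC_intro (swap_product_swap (fun i => swap_axioms (S i))).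
exact: isomorphic_transport (@zip3K _ _ _).
Qed.

(** * Failure for homomorphic images *)

Section FullMultialgebra.
Variables (U : Type) (u0 : U).

(** Any function from a multialgebra into this one is a homomorphism, and the homomorphic image does
    not depend on the operations of the target. *)
Definition full_multialgebra : multialgebra U :=
  {| dom := setT;
     mop := fun _ _ => setT;
     dom_nonempty := ex_intro _ u0 I;
     mop_nonempty := fun _ _ _ => ex_intro _ u0 I;
     mop_dom := fun _ _ _ _ _ => I |}.

End FullMultialgebra.

Section FullSwap.
Variables (d : Order.disp_t) (L : ctbDistrLatticeType d).
Local Open Scope order_scope.

Definition first_component c : (arity c).-tuple (L * L * L) -> L :=
  match c with
  | Conj => fun a => (tnth a ord0).1.1 `&` (tnth a ord_max).1.1
  | Disj => fun a => (tnth a ord0).1.1 `|` (tnth a ord_max).1.1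
  | Impl => fun a => bool_impl (tnth a ord0).1.1 (tnth a ord_max).1.1
  | Neg => fun a => (tnth a ord0).1.2
  | Circ => fun a => (tnth a ord0).2
  end.

Let full_swap_mop c (a : (arity c).-tuple (L * L * L)) : set (L * L * L) :=
  [set u | swap_universe L u /\ u.1.1 = first_component a].

(** Every element of [L] is thus a first component, which makes the operations of [full_swap]
    nonempty. *)
Lemma swap_universe_compl (x : L) : swap_universe L (x, ~` x, \bot).
Proof. by split; rewrite /= ?joinxC ?meetx0. Qed.

Let full_swap_dom_nonempty : swap_universe L !=set0.
Proof. by exists (\bot, ~` \bot, \bot); exact: swap_universe_compl. Qed.

Let full_swap_mop_nonempty c a :
  tuple_in (swap_universe L) a -> @full_swap_mop c a !=set0.
Proof.
move=> _; exists (first_component a, ~` first_component a, \bot).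
by split; first exact: swap_universe_compl.
Qed.

Let full_swap_mop_dom c a :
  tuple_in (swap_universe L) a -> @full_swap_mop c a `<=` swap_universe L.
Proof. by move=> _ u []. Qed.

(** The largest swap structure over [L]. *)
Definition full_swap : multialgebra (L * L * L) :=
  {| dom := swap_universe L;
     mop := full_swap_mop;
     dom_nonempty := full_swap_dom_nonempty;
     mop_nonempty := full_swap_mop_nonempty;
     mop_dom := full_swap_mop_dom |}.

Lemma full_swap_swap : is_swap_mbC L full_swap.
Proof.
split=> [//||z w _ _|z _ u []|z _ u []] //.
  by exists (\bot, ~` \bot, \bot); first exact: swap_universe_compl.
by split=> u [].
Qed.

End FullSwap.

Definition third_hom :
    homomorphism (full_swap bool) (full_multialgebra true).
Proof. by exists (fun z => z.2). Defined.

Lemma swap_collapse (d : Order.disp_t) (L : ctbDistrLatticeType d)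
    (B : multialgebra (L * L * L)) a b :
  is_swap_mbC L B -> dom B `<=` [set a; b] -> dom B a ->
  mop B Conj [tuple a; a] b -> a = b.
Proof.
move=> [Buniv [z zB z0] Bbin _ _] Bab aB aab.
have [conjB _ _] := Bbin a a aB aB.
have [bB b1] := conjB b aab; rewrite meetxx in b1.
have first_a w : dom B w -> w.1.1 = a.1.1 by move=> /Bab [] ->.
have first0 w : dom B w -> w.1.1 = \bot%O.
  by move=> wB; rewrite -z0 !first_a.
have [u uP] := mop_nonempty (c := Impl) (tuple_in2 aB aB).
have [_ _ /(_ u uP) [uB u1]] := Bbin a a aB aB.
(* [u] has first component 0 like all of [B], but as a value of [a -> a] it has first component
   [0 -> 0 = 1]. *)
have top0 : \bot%O = \top%O :> L.
  by rewrite -(first0 u uB) u1 /bool_impl (first0 a aB) joinx0 compl0.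
have L0 (x y : L) : x = y by rewrite -(meetx1 x) -(meetx1 y) -top0 !meetx0.
case: a {Bab aB aab conjB b1 first_a uP u1} => [[a1 a2] a3].
by case: b {bB} => [[b1 b2] b3]; rewrite (L0 a1 b1) (L0 a2 b2) (L0 a3 b3).
Qed.

Lemma not_K_mbC_hom_image : ~ closed_under_homomorphic_images K_mbC.
Proof.
move=> /(_ _ _ _ _ third_hom (K_mbC_intro (full_swap_swap bool))).
move=> [V [B [KB [g [gbij gop]]]]].
have imT b : dom (hom_image third_hom) b.
  by exists (false, true, b) => //; split; case: b.
(* Conjunction fixes only the first component of its values; when that is 0 and the second is 1, the
   third is free. *)
have ffx b : mop (hom_image third_hom) Conj [tuple false; false] b.
  exists [tuple (false, true, false); (false, true, false)].
    by split; [apply: tuple_in2; split|exact: val_inj].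
  by exists (false, true, b) => //; split=> //; split; case: b.
have [gD ginj gsurj] := gbij.
suff : g false = g true.
  by move=> /ginj; rewrite !inE => /(_ (imT _) (imT _)).
have conj_g b : mop B Conj [tuple g false; g false] (g b).
  rewrite -map_tuple2 -gop; first by exists b.
  by apply: tuple_in2; apply: imT.
have domB : dom B `<=` [set g false; g true].
  by move=> _ /gsurj [[] _ <-]; [right|left].
have gfB : dom B (g false) by apply: gD.
move: gfB domB (conj_g true).
(* Case analysis on [KB] replaces the type [V], so the two values of [g] are first generalized and
   [g] is dropped. *)
move: (g false) (g true) => a b {conj_g gD ginj gsurj gop gbij g}.
case: KB a b => d L {V}B swapB a b aB Bab.
exact: swap_collapse.
Qed.

Theorem proposition7p8 :
  closed_under_submultialgebras K_mbC /\
  closed_under_products K_mbC /\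
  ~ closed_under_homomorphic_images K_mbC.
Proof.
split; first exact: K_mbC_sub.
split; [exact: K_mbC_product | exact: not_K_mbC_hom_image].
Qed.
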